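(* If $f$ is a unimodal map (with non-periodic turning point) such that $\mathcal K(f)$ is a linearly recurrent sequence, then $\mathcal K(f)$ is not slowly recurrent.
   Context: A unimodal map is a continuous $f:[0,1]\to[0,1]$ with a turning point $c\in(0,1)$, strictly increasing on $[0,c]$ and strictly decreasing on $[c,1]$; $c_i=f^i(c)$, with $c_2<c<c_1$, $c_2<c_3$. It is assumed that $f$ has no periodic attractor, is not renormalizable (there is no $n>1$ and interval $J\subset[c_2,c_1]$ containing $c$ with $f^n(J)\subset J$ and $J,\dots,f^{n-1}(J)$ having disjoint interiors), and that $c$ is not periodic. $\mathcal K(f)=e_1e_2\cdots$ with $e_i=1$ if $c_i>c$ and $e_i=0$ if $c_i<c$. $\mathcal R(n)=\min\{j\ge1:e_{n+j}\ne e_j\}$ (finite for every $n$). An infinite sequence $\overline x$ is linearly recurrent if there is $L\in\mathbb N$ such that every finite word $w$ appearing in $\overline x$ appears with gap $\le L\cdot|w|$. $\mathcal K(f)$ is slowly recurrent if $$\lim_{l\to\infty}\limsup_{i\to\infty}\frac1i\sum_{\substack{1\le j\le i\\ \mathcal R(j)\ge l}}\mathcal R(j)=0.$$ *)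

(* Defs.v *)
From HB Require Import structures.
From mathcomp Require Import all_boot all_order all_algebra.
From mathcomp Require Import all_classical all_reals all_analysis.

Set Implicit Arguments.
Unset Strict Implicit.
Unset Printing Implicit Defensive.

Import Order.TTheory GRing.Theory Num.Theory.
Import numFieldNormedType.Exports.

Local Open Scope classical_set_scope.
Local Open Scope ring_scope.

(* A self-map of [0,1] is represented by a function f : R -> R preserving
   [0,1]; its values outside [0,1] are irrelevant.  The point c_i = f^i(c) is
   written iter i f c. *)
Record unimodal (R : realType) (f : R -> R) (c : R) : Prop := Unimodal {
  unimodal_map : {homo f : x / x \in `[0, 1]};
  unimodal_continuous : {within `[0, 1], continuous f};
  unimodal_turning : c \in `]0, 1[;
  unimodal_increasing : {in `[0, c] &, {homo f : x y / x < y}};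
  unimodal_decreasing : {in `[c, 1] &, {homo f : x y / x < y >-> y < x}};
  unimodal_c2_lt_c : iter 2 f c < c;
  unimodal_c_lt_c1 : c < iter 1 f c;
  unimodal_c2_lt_c3 : iter 2 f c < iter 3 f c
}.

Definition periodic_point (R : realType) (f : R -> R) (p : R) : Prop :=
  exists n : nat, (0 < n)%N /\ iter n f p = p.

(* The points of [0,1] whose orbits accumulate only on the orbit of p. *)
Definition basin (R : realType) (f : R -> R) (p : R) : set R :=
  [set x | x \in `[0, 1] /\
    forall eps : R, 0 < eps ->
      \forall k \near \oo, exists i : nat, `|iter k f x - iter i f p| < eps].

(* Asking only that the basin have nonempty interior includes the periodic
   orbits that attract from one side. *)
Definition has_periodic_attractor (R : realType) (f : R -> R) : Prop :=
  exists p : R,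
    [/\ p \in `[0, 1], periodic_point f p & (basin f p)° !=set0].

Definition renormalizable (R : realType) (f : R -> R) (c : R) : Prop :=
  exists (n : nat) (J : set R),
    [/\ (1 < n)%N,
        is_interval J /\ J c,
        J `<=` `[iter 2 f c, iter 1 f c],
        iter n f @` J `<=` J &
        forall i j : nat, (i < j < n)%N ->
          (iter i f @` J)° `&` (iter j f @` J)° = set0].

(* Infinite words x_1 x_2 ... are functions on nat whose value at 0 is never
   used. *)
Definition kneading (R : realType) (f : R -> R) (c : R) : nat -> bool :=
  fun i => c < iter i f c.

Definition occurs_at (T : Type) (x : nat -> T) (w : seq T) (i : nat) : Prop :=
  (0 < i)%N /\ mkseq (fun k => x (i + k)%N) (size w) = w.

Definition linearly_recurrent (T : Type) (x : nat -> T) : Prop :=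
  exists L : nat, forall w : seq T, (0 < size w)%N ->
    forall i : nat, occurs_at x w i ->
      exists j : nat, (i < j <= i + L * size w)%N /\ occurs_at x w j.

(* min {j >= 1 : x_(n+j) != x_j}, and 0 when there is no such j.  For n >= 1
   and the kneading sequence of a map without periodic attractor whose turning
   point is not periodic, the second case does not arise. *)
Definition recurrence_time (x : nat -> bool) (n : nat) : nat :=
  match pselect (exists j : nat, (0 < j)%N && (x (n + j)%N != x j)) with
  | left h => ex_minn h
  | right _ => 0%N
  end.

(* The inner upper limit may be +oo, hence the extended reals. *)
Definition slowly_recurrent (R : realType) (x : nat -> bool) : Prop :=
  (fun l : nat => limn_esup (fun i : nat =>
     (i%:R^-1 * \sum_(1 <= j < i.+1 | (l <= recurrence_time x j)%N)
        (recurrence_time x j)%:R)%:E : \bar R)) @ \oo --> (0 : \bar R)%E.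

(* Main.v *)
(* If the prefix of length l of K(f) reappears at position n + 1, then
   R(n) > l.  Linear recurrence makes it reappear with gaps at most L l, so the
   terms with R(j) >= l already contribute at least k l to the sum up to
   i = k L l, and the upper limit is at least 1/L for every l.

   This needs R(n) to be finite.  If R(n) were infinite, all the points
   f^(2nk)(c_1) would have the itinerary of c_1, f^(2n) would be increasing on
   their hull, and they would decrease to a periodic point p; every point
   between f^(2n)(c_1) and c_1 would then be attracted by the orbit of p. *)
Require Import Defs.
From HB Require Import structures.
From mathcomp Require Import all_boot all_order all_algebra.
From mathcomp Require Import all_classical all_reals all_analysis.
From mathcomp Require Import lra zify.

Set Implicit Arguments.
Unset Strict Implicit.
Unset Printing Implicit Defensive.

Import Order.TTheory GRing.Theory Num.Theory.
Import numFieldNormedType.Exports.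

Local Open Scope classical_set_scope.
Local Open Scope ring_scope.

(** * Orientation of iterates and periodic itineraries *)

Definition signed_le (R : realType) (s : bool) (x y : R) : bool :=
  if s then y <= x else x <= y.

(* The inequalities are weak, so that a point whose orbit hits c may follow
   several codes. *)
Definition follows (R : realType) (f : R -> R) (c : R) (e : nat -> bool)
    (x : R) : Prop :=
  x \in `[0, 1] /\ forall i, signed_le (e i) (iter i f x) c.

(** Visits to the decreasing branch are counted modulo 2: the value [true] means that [f^j] reverses
    order among points following [e]. *)
Definition parity (e : nat -> bool) (j : nat) : bool :=
  odd (\sum_(i < j) e i).

Lemma parityS (e : nat -> bool) (j : nat) :
  parity e j.+1 = parity e j (+) e j.
Proof. by rewrite /parity big_ord_recr oddD; case: (e j). Qed.

(** Both copies of the period contribute the same count. Hence the doubled period below: it makes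
    the iterate preserve order. *)
Lemma parity_double_period (e : nat -> bool) (n : nat) :
  (forall i, e (n + i)%N = e i) -> parity e (n + n) = false.
Proof.
move=> per; rewrite /parity big_split_ord /= oddD.
by under [X in _ (+) odd X]eq_bigr => i _ do rewrite per; rewrite addbb.
Qed.

Section UnimodalItineraries.
Context (R : realType) (f : R -> R) (c : R).
Hypothesis uf : unimodal f c.

Lemma unimodal_iter (x : R) (j : nat) : x \in `[0, 1] -> iter j f x \in `[0, 1].
Proof. by move=> x01; elim: j => //= j; exact: (unimodal_map uf). Qed.

Lemma turning_in01 : c \in `[0, 1].
Proof. by apply: subset_itv_oo_cc; exact: unimodal_turning uf. Qed.

Lemma unimodal_lt_turning (x : R) : x \in `[0, 1] -> x != c -> f x < f c.
Proof.
have := turning_in01; rewrite !in_itv /= => /andP[c0 c1] /andP[x0 x1].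
case: (ltgtP x c) => // xc _.
  by apply: (unimodal_increasing uf); rewrite // in_itv /= ?lexx ?c0 ?x0 ?ltW.
by apply: (unimodal_decreasing uf); rewrite // in_itv /= ?lexx ?c1 ?x1 ?ltW.
Qed.

Lemma unimodal_signed_le (s b : bool) (x y : R) :
  x \in `[0, 1] -> y \in `[0, 1] -> signed_le b x c -> signed_le b y c ->
  signed_le s x y -> signed_le (s (+) b) (f x) (f y).
Proof.
rewrite !in_itv /= => /andP[x0 x1] /andP[y0 y1].
wlog -> : s x y x0 x1 y0 y1 / s = false.
  move=> W; case: s => xc yc; last exact: W.
  move=> xy; have := W false y x y0 y1 x0 x1 erefl yc xc xy.
  by rewrite addTb addFb; case: (b).
rewrite /signed_le /=; case: b => xc yc; rewrite le_eqVlt => /predU1P[->//|xy].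
- by apply/ltW/(unimodal_decreasing uf) => //; rewrite in_itv /= ?xc ?yc.
- by apply/ltW/(unimodal_increasing uf) => //; rewrite in_itv /= ?x0 ?y0.
Qed.

(** By induction [f^j t] lies between two points on the same side of [c], so all three pass through
    the same monotone branch. *)
Lemma iter_between (e : nat -> bool) (x y t : R) (j : nat) :
  follows f c e x -> follows f c e y -> x <= t <= y ->
  signed_le (parity e j) (iter j f x) (iter j f t) /\
  signed_le (parity e j) (iter j f t) (iter j f y).
Proof.
move=> [x01 ex] [y01 ey] /andP[xt ty].
have t01 : t \in `[0, 1].
  move: x01 y01; rewrite !in_itv /= => /andP[x0 _] /andP[_ y1].
  by rewrite (le_trans x0 xt) (le_trans ty y1).
elim: j => [|j [IHx IHy]]; first by rewrite /parity big_ord0.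
have tc : signed_le (e j) (iter j f t) c.
  have := ex j; have := ey j; move: IHx IHy; rewrite /signed_le.
  by case: (e j); case: (parity e j) => *; lra.
by rewrite parityS /=; split; apply: unimodal_signed_le => //;
  exact: unimodal_iter.
Qed.

Lemma cvg_iter (u : nat -> R) (p : R) (r : nat) :
  (forall k, u k \in `[0, 1]) -> p \in `[0, 1] -> u @ \oo --> p ->
  (fun k => iter r f (u k)) @ \oo --> iter r f p.
Proof.
move=> u01 p01 up; elim: r => //= r IHr.
have /subspace_continuousP/(_ (iter r f p) (unimodal_iter r p01)) :=
  unimodal_continuous uf.
(* Continuity holds only relative to [[0, 1]]; invariance of the interval keeps the sequence in the
   subspace. *)
apply: cvg_trans => A /IHr; rewrite /= /nbhs /=; apply: filterS => k; apply.
exact: unimodal_iter.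
Qed.

Lemma kneading_period_attractor (n : nat) :
  (0 < n)%N -> ~ periodic_point f c ->
  (forall i, (0 < i)%N -> kneading f c (n + i) = kneading f c i) ->
  has_periodic_attractor f.
Proof.
move=> n0 cNper Kper.
pose e i := kneading f c i.+1; pose m := (n + n)%N.
have ePer k i : e (n * k + i)%N = e i.
  elim: k => [|k IHk]; first by rewrite muln0.
  by rewrite mulnS -addnA -IHk /e -addnS Kper.
have evenP k : parity e (m * k) = false.
  by rewrite /m mulnDl parity_double_period.
pose z k := iter (m * k) f (f c).
have z01 k : z k \in `[0, 1].
  by apply/unimodal_iter/(unimodal_map uf)/turning_in01.
have zF k : follows f c e (z k).
  split=> // i; rewrite /z -iterD addnC -iterSr.
  rewrite -(ePer (k + k)%N) /e /kneading mulnDr -mulnDl -/m.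
  by rewrite /signed_le; case: ltP => // /ltW.
have zS k : z k.+1 = iter (m * k) f (z 1%N).
  by rewrite /z -iterD muln1 mulnS addnC.
(* Here [z 1] is [f (f^m c)], and [f] attains its maximum only at [c], which is not [f^m c]. *)
have z1_lt : z 1%N < z 0%N.
  rewrite /z muln0 muln1 -iterSr /=; apply: unimodal_lt_turning.
    exact/unimodal_iter/turning_in01.
  by apply/eqP => cm; apply: cNper; exists m; rewrite addn_gt0 n0.
have squeeze t k : z 1%N <= t <= z 0%N -> z k.+1 <= iter (m * k) f t <= z k.
  move=> /(iter_between (m * k) (zF 1%N) (zF 0%N)); rewrite evenP -zS.
  by rewrite /signed_le => -[-> ]; rewrite /z muln0.
have z_noninc : nonincreasing_seq z.
  apply/nonincreasing_seqP => k.
  by have /andP[/le_trans h /h] := squeeze (z 0%N) k ltac:(by rewrite lexx ltW).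
have z_cvg : cvgn z.
  apply: nonincreasing_is_cvgn => //; exists 0 => _ [k _ <-].
  by have := z01 k; rewrite in_itv /= => /andP[].
pose p := limn z; have zp : z @ \oo --> p by [].
have p01 : p \in `[0, 1].
  rewrite in_itv /=; apply/andP; split.
    by apply: limr_ge => //; apply: nearW => k; have := z01 k;
      rewrite in_itv /= => /andP[].
  by apply: limr_le => //; apply: nearW => k; have := z01 k;
    rewrite in_itv /= => /andP[].
have zSp : (fun k => z k.+1) @ \oo --> p by rewrite (cvg_shiftS z).
have pP : iter m f p = p.
  have /cvg_lim <- // := cvg_iter (r := m) z01 p01 zp.
  apply/cvg_lim => //; apply: cvg_trans zSp.
  by apply: near_eq_cvg; apply: nearW => k; rewrite /z -iterD mulnS.
exists p; split=> //; first by exists m; rewrite addn_gt0 n0.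
exists ((z 1%N + z 0%N) / 2).
apply: (@filterS _ _ _ `]z 1%N, z 0%N[); last first.
  by apply: near_in_itvoo; rewrite in_itv /=; apply/andP; split; lra.
move=> t; rewrite /= in_itv /= => /andP[/ltW t1 /ltW t0].
have t01 : t \in `[0, 1].
  have := z01 0%N; have := z01 1%N; rewrite !in_itv /= => /andP[? _] /andP[_ ?].
  by apply/andP; split; lra.
split=> // eps eps0.
pose y k := iter (m * k) f t.
have y01 k : y k \in `[0, 1] by exact: unimodal_iter.
have yp : y @ \oo --> p.
  apply: (squeeze_cvgr _ zSp zp).
  by apply: nearW => k; apply: squeeze; rewrite t1 t0.
(* The basin concerns all times, while [y] samples every [m]-th one; finitely many residues share a
   threshold. *)
have close r : \forall k \near \oo, forall s, (s < r)%N ->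
    `|iter s f (y k) - iter s f p| < eps.
  elim: r => [|r IHr]; first exact: nearW.
  have /cvgrPdist_lt/(_ _ eps0) := cvg_iter (r := r) y01 p01 yp.
  apply: filterS2 IHr => k IHk yr s.
  by rewrite ltnS leq_eqVlt => /predU1P[->|/IHk//]; rewrite distrC.
have m0 : (0 < m)%N by rewrite addn_gt0 n0.
have [N _ closeN] := close m; exists (m * N)%N => // k /= Nk.
exists (k %% m)%N.
have := closeN (k %/ m)%N _ (k %% m)%N (ltn_pmod _ m0).
rewrite /y -iterD addnC mulnC -divn_eq; apply.
by rewrite /= leq_divRL // mulnC.
Qed.

End UnimodalItineraries.

(** * Recurrence times and returns of a prefix *)

Section RecurrenceTimes.
Variable x : nat -> bool.
Hypothesis x_nonperiodic :
  forall n, (0 < n)%N -> exists j, (0 < j)%N && (x (n + j)%N != x j).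

Lemma recurrence_time_gt (n l : nat) :
  (0 < n)%N -> (forall j, (0 < j <= l)%N -> x (n + j)%N = x j) ->
  (l < recurrence_time x n)%N.
Proof.
move=> n0 xE; rewrite /recurrence_time.
(* Non-periodicity excludes the default value 0. *)
case: pselect => [h|/(_ (x_nonperiodic n0))//].
case: ex_minnP => j /andP[j0 xj] _; rewrite ltnNge; apply/negP => jl.
by move: xj; rewrite xE ?eqxx // j0.
Qed.

Definition large_recurrence_sum (l i : nat) : nat :=
  \sum_(1 <= j < i.+1 | (l <= recurrence_time x j)%N) recurrence_time x j.

Lemma large_recurrence_sum_mono (l : nat) :
  {homo large_recurrence_sum l : i j / (i <= j)%N}.
Proof.
move=> i j ij; rewrite /large_recurrence_sum.
by rewrite (@big_cat_nat _ _ _ i.+1 1 j.+1) //= leq_addr.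
Qed.

Lemma large_recurrence_sum_ge (L l : nat) :
  (0 < l)%N ->
  (forall w : seq bool, (0 < size w)%N -> forall i, occurs_at x w i ->
     exists j, (i < j <= i + L * size w)%N /\ occurs_at x w j) ->
  forall k, (k * l <= large_recurrence_sum l (k * (L * l)))%N.
Proof.
move=> l0 rec k; pose w := mkseq (fun k => x (1 + k)%N) l.
have sw : size w = l by rewrite size_mkseq.
(* An occurrence at [p + 1] is what bounds R(p) from below. The start [p = 0] is the prefix itself,
   which adds no term. *)
suff [p [pk _ /leq_trans]] : exists p, [/\ (p <= k * (L * l))%N,
    occurs_at x w p.+1 & (k * l <= large_recurrence_sum l p)%N].
  by apply; exact: large_recurrence_sum_mono.
elim: k => [|k [p [pk occ IH]]].
  by exists 0%N; rewrite mul0n; split=> //; split; rewrite // sw.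
have [] := rec w _ _ occ; first by rewrite sw.
rewrite sw => -[[/andP[]//]|q] [/andP[pq qp] occq].
exists q; split=> //; first by lia.
have q0 : (0 < q)%N by lia.
have lq : (l < recurrence_time x q)%N.
  apply: recurrence_time_gt => // j /andP[j0 jl].
  case: occq => _ /(congr1 (fun s => nth false s j.-1)).
  rewrite sw !nth_mkseq ?prednK // !add1n addSn.
  by rewrite -addnS prednK.
(* The term [j = q] is new: since [p < q], the sum up to [q - 1] already contains the one up to
   [p]. *)
have -> : large_recurrence_sum l q
    = (large_recurrence_sum l q.-1 + recurrence_time x q)%N.
  rewrite /large_recurrence_sum prednK // big_mkcond big_nat_recr //=.
  by rewrite -big_mkcond (ltnW lq).
rewrite mulSn addnC leq_add ?(ltnW lq) // (leq_trans IH) //.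
by apply: large_recurrence_sum_mono; lia.
Qed.

End RecurrenceTimes.

Lemma limn_esup_ge (R : realType) (u : nat -> \bar R) (a : \bar R) :
  (forall n, exists2 k, (n <= k)%N & (a <= u k)%E) -> (a <= limn_esup u)%E.
Proof.
move=> ua; rewrite limn_esup_lim; apply: lime_ge; first exact: is_cvg_esups.
apply: nearW => n; have [k nk ak] := ua n.
by apply: (le_trans ak); apply: ereal_sup_ubound; exists k.
Qed.

Lemma linearly_recurrent_not_slow (R : realType) (x : nat -> bool) :
  (forall n, (0 < n)%N -> exists j, (0 < j)%N && (x (n + j)%N != x j)) ->
  linearly_recurrent x -> ~ slowly_recurrent R x.
Proof.
move=> xnp [L rec] slow.
(* A one-letter word must reappear strictly later, within [L] places. *)
have L0 : (0 < L)%N.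
  have [|//|j [/andP[ij jL] _]] := rec [:: x 1%N] _ 1%N; first by split.
  by move: jL; rewrite muln1; lia.
suff : ((L%:R^-1)%:E <= 0 :> \bar R)%E.
  by rewrite lee_fin leNgt invr_gt0 ltr0n L0.
rewrite -(cvg_lim _ slow) //; apply: lime_ge; first by apply/cvg_ex; exists 0%E.
(* For [l = 0] the prefix is empty and recurrence says nothing. *)
exists 1%N => // l /= l0; apply: limn_esup_ge => n.
(* With [k = n + 1] this index is positive and at least [n], and the average there is at least
   [k l / (k L l)]. *)
exists (n.+1 * (L * l))%N.
  by rewrite (leq_trans (leqnSn n)) // leq_pmulr // muln_gt0 L0.
rewrite lee_fin -natr_sum -/(large_recurrence_sum x l _).
have := large_recurrence_sum_ge xnp l0 rec n.+1.
set S := large_recurrence_sum _ _ _ => leS.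
have Ll0 : (0 : R) < (n.+1 * (L * l))%:R by rewrite ltr0n !muln_gt0 L0.
rewrite ler_pdivlMl // ler_pdivrMr ?ltr0n // -natrM ler_nat.
by rewrite mulnCA mulnC leq_mul2r leS orbT.
Qed.

Theorem proposition5p5 (R : realType) (f : R -> R) (c : R)
    (f_unimodal : unimodal f c)
    (no_attractor : ~ has_periodic_attractor f)
    (not_renorm : ~ renormalizable f c)
    (c_not_periodic : ~ periodic_point f c)
    (K_linrec : linearly_recurrent (kneading f c)) :
  ~ slowly_recurrent R (kneading f c).
Proof.
apply: linearly_recurrent_not_slow K_linrec => n n0.
(* Without a mismatch the kneading sequence would have period [n]. *)
apply: contrapT => Kper; apply: no_attractor.
apply: (kneading_period_attractor f_unimodal n0 c_not_periodic) => i i0.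
by apply/eqP; apply: contrapT => /negP Ki; apply: Kper; exists i; rewrite i0.
Qed.
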